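(* Over a sequence of $m$ arc additions, two-way compatible search does at most $4m^{3/2}+m+1$ arc traversals in total.
   Context: Incremental setting: a fixed vertex set, initially no arcs; $m$ distinct arcs are added one at a time, and processing stops once a cycle is detected (so the graph is acyclic before each processed addition). A topological order $<$ is maintained (initially arbitrary). When an arc $(v,w)$ with $v<w$ is added nothing is done; when $v>w$, compatible search is run, comparisons in the order before the addition and on the arcs other than $(v,w)$: set $F=\{w\}$, $B=\{v\}$, $A_F=\{\text{arcs out of } w\}$, $A_B=\{\text{arcs into } v\}$. While there exist $(u,x)\in A_F$ and $(y,z)\in A_B$ with $u<z$: choose any such pair and remove them from $A_F$ and $A_B$ (this counts as a forward traversal of $(u,x)$ and a backward traversal of $(y,z)$, i.e. two arc traversals); if $x\in B$ return $(u,x)$ (cycle); else if $y\in F$ return $(y,z)$ (cycle); if $x\notin F$ add $x$ to $F$ and all arcs out of $x$ to $A_F$; if $y\notin B$ add $y$ to $B$ and all arcs into $y$ to $A_B$. If the loop ends, return null and reorder: with $t=\min(\{v\}\cup\{u:\exists (u,x)\in A_F\})$, $F_<=\{x\in F:x<t\}$, $B_>=\{y\in B:y>t\}$, if $t=v$ move $F_<$ just after $t$, else move $F_<$ just before $t$ and $B_>$ just before $F_<$, ordering each of $F_<$, $B_>$ internally topologically. *)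

(* Defs.v *)
From mathcomp Require Import all_boot.

Set Implicit Arguments.
Unset Strict Implicit.
Unset Printing Implicit Defensive.

Definition has_cycle (V : finType) (G : {set V * V}) : Prop :=
  exists2 c : seq V, c != [::] & cycle (fun a b => (a, b) \in G) c.

(* A total order on V is represented by the list of all vertices in increasing
   order. *)
Definition before (V : finType) (ord : seq V) (a b : V) : bool :=
  (index a ord < index b ord)%N.

(* l lists S, each vertex once, in an order that is topological for the
   subgraph of G induced by S. *)
Definition topological (V : finType) (G : {set V * V}) (S : {set V})
    (l : seq V) : bool :=
  perm_eq l (enum S) && pairwise (fun a b => (b, a) \notin G) l.

Definition arcs_from (V : finType) (G : {set V * V}) (a : V) : {set V * V} :=
  [set e in G | e.1 == a].

Definition arcs_into (V : finType) (G : {set V * V}) (a : V) : {set V * V} :=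
  [set e in G | e.2 == a].

(* Null records the values of F, B and A_F on exit from the loop. *)
Variant search_result (V : finType) : Type :=
  | CycleArc of V * V
  | Null of {set V} & {set V} & {set V * V}.

(* [search G ord F B AF AB r k]: the loop, entered with the given values of
   F, B, A_F, A_B, can end with result r after k arc traversals.  It is a
   relation because the traversed pair of arcs is an arbitrary choice. *)
Inductive search (V : finType) (G : {set V * V}) (ord : seq V)
    (F B : {set V}) (AF AB : {set V * V}) : search_result V -> nat -> Prop :=
  | SearchEnd :
      (forall u x y z, (u, x) \in AF -> (y, z) \in AB -> ~~ before ord u z) ->
      search G ord F B AF AB (Null F B AF) 0
  | SearchForwardCycle u x y z :
      (u, x) \in AF -> (y, z) \in AB -> before ord u z ->
      x \in B ->
      search G ord F B AF AB (CycleArc (u, x)) 2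
  | SearchBackwardCycle u x y z :
      (u, x) \in AF -> (y, z) \in AB -> before ord u z ->
      x \notin B -> y \in F ->
      search G ord F B AF AB (CycleArc (y, z)) 2
  | SearchStep u x y z r k :
      (u, x) \in AF -> (y, z) \in AB -> before ord u z ->
      x \notin B -> y \notin F ->
      search G ord (x |: F) (y |: B)
        (AF :\ (u, x) :|: (if x \in F then set0 else arcs_from G x))
        (AB :\ (y, z) :|: (if y \in B then set0 else arcs_into G y)) r k ->
      search G ord F B AF AB r (k + 2).

Definition compatible_search (V : finType) (G : {set V * V}) (ord : seq V)
    (v w : V) : search_result V -> nat -> Prop :=
  search G ord [set w] [set v] (arcs_from G w) (arcs_into G v).

Definition threshold (V : finType) (ord : seq V) (v : V) (AF : {set V * V}) :
    V :=
  [arg min_(u < v | (u == v) || [exists x, (u, x) \in AF]) index u ord].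

Definition move_after (V : finType) (t : V) (l ord : seq V) : seq V :=
  let rest := [seq a <- ord | a \notin l] in
  take (index t rest).+1 rest ++ l ++ drop (index t rest).+1 rest.

Definition move_before (V : finType) (t : V) (l ord : seq V) : seq V :=
  let rest := [seq a <- ord | a \notin l] in
  take (index t rest) rest ++ l ++ drop (index t rest) rest.

(* G is the graph after the addition. *)
Definition reordered (V : finType) (G : {set V * V}) (ord : seq V) (v : V)
    (F B : {set V}) (AF : {set V * V}) (ord' : seq V) : Prop :=
  let t := threshold ord v AF in
  exists lF lB : seq V,
    [/\ topological G [set x in F | before ord x t] lF,
        topological G [set y in B | before ord t y] lB &
        ord' = if t == v then move_after t lF ord
               else move_before t (lB ++ lF) ord].

(* [add_arc G ord e o k]: adding the arc e can take k arc traversals and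
   report a cycle (o = None) or end with the order ord' (o = Some ord').
   A loop is a cycle by itself and is reported without a search. *)
Inductive add_arc (V : finType) (G : {set V * V}) (ord : seq V) :
    V * V -> option (seq V) -> nat -> Prop :=
  | AddForward v w :
      before ord v w -> add_arc G ord (v, w) (Some ord) 0
  | AddLoop v :
      add_arc G ord (v, v) None 0
  | AddCycle v w e k :
      before ord w v -> compatible_search G ord v w (CycleArc e) k ->
      add_arc G ord (v, w) None k
  | AddReorder v w F B AF ord' k :
      before ord w v -> compatible_search G ord v w (Null F B AF) k ->
      reordered ((v, w) |: G) ord v F B AF ord' ->
      add_arc G ord (v, w) (Some ord') k.

(* [run G ord arcs k]: starting from the graph G and the order ord, processing
   the additions in the list arcs can take k arc traversals in total.
   Every processed addition is made to an acyclic graph.  Stopping when the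
   search reports a cycle does not quite ensure this: with arcs w -> x -> v, a
   step may add the same vertex x to both F and B, and the search can then
   return Null although (v, w) closes a cycle.  Hence the second condition in
   RunStop. *)
Inductive run (V : finType) (G : {set V * V}) (ord : seq V) :
    seq (V * V) -> nat -> Prop :=
  | RunEnd : run G ord [::] 0
  | RunStop e arcs o k :
      add_arc G ord e o k -> o = None \/ has_cycle (e |: G) ->
      run G ord (e :: arcs) k
  | RunContinue e arcs ord' k k' :
      add_arc G ord e (Some ord') k -> ~ has_cycle (e |: G) ->
      run (e |: G) ord' arcs k' ->
      run G ord (e :: arcs) (k + k').

(* Main.v *)
(* Call an ordered pair (e, f) of arcs linked if the head of e reaches the tail
   of f.  Linking never happens in both directions in an acyclic graph, so at
   most half of all the pairs of arcs are linked.  A search that traverses j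
   compatible pairs (f, b) and closes no cycle links at least j^2 / 2 new pairs
   (b, f): if f = (u, x), b = (y, z) and u < z then b was not linked to f, since
   the order is topological, but the new arc (v, w) gives a path from z through
   v and w to u.  Hence the sum of j^2 over these searches is at most m^2, and
   that of j is at most m^(3/2) by Cauchy-Schwarz.  In the last search an arc
   that is traversed in both directions ends the search, so that it makes at
   most m + 1 traversals. *)
Require Import Defs.
From mathcomp Require Import all_boot all_order all_algebra.
From mathcomp Require Import reals exp.
From mathcomp Require Import lra.

Import Order.TTheory GRing.Theory Num.Theory.

Set Implicit Arguments.
Unset Strict Implicit.
Unset Printing Implicit Defensive.

(** * Paths, acyclic graphs and moves within a vertex order *)

Definition arc_rel (V : finType) (G : {set V * V}) : rel V :=
  fun a b => (a, b) \in G.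

Section Orders.
Variable V : finType.
Implicit Types (G : {set V * V}) (ord l : seq V) (a b t v w : V) (e : V * V).

Lemma arc_connect G e : e \in G -> connect (arc_rel G) e.1 e.2.
Proof. by case: e => a b /= ab; apply: connect1. Qed.

Lemma connect_setU1 G e a b :
  connect (arc_rel G) a b -> connect (arc_rel (e |: G)) a b.
Proof.
by apply: connect_sub => c d cd; apply: connect1; apply: setU1r.
Qed.

Lemma acyclic_connect G a b :
  ~ has_cycle G -> (a, b) \in G -> ~~ connect (arc_rel G) b a.
Proof.
move=> acG ab; apply/negP=> /connectP[p pth lst]; apply: acG.
by exists (b :: p) => //=; rewrite rcons_path pth -lst.
Qed.

Lemma acyclicW G e : ~ has_cycle (e |: G) -> ~ has_cycle G.
Proof.
move=> acG [c c0 cyc]; apply: acG; exists c => //.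
by apply: sub_cycle cyc => a b; apply: setU1r.
Qed.

(** [pairwise] compares distinct positions only and so says nothing about loops; acyclicity excludes
    them and makes the inequality strict. *)
Lemma topologicalP G ord : ~ has_cycle G -> topological G [set: V] ord ->
  [/\ uniq ord, forall a, a \in ord &
      forall a b, (a, b) \in G -> before ord a b].
Proof.
move=> acG /andP[perm_ord pw].
have uo : uniq ord by rewrite (perm_uniq perm_ord) enum_uniq.
have mo a : a \in ord by rewrite (perm_mem perm_ord) mem_enum inE.
split=> // a b ab; rewrite /before ltnNge leq_eqVlt.
apply/negP=> /orP[/eqP eqi|].
  have eqab : a = b by rewrite -(nth_index a (mo a)) -eqi nth_index.
  by have := acyclic_connect acG ab; rewrite eqab connect0.
move=> lt_ba; have /(pairwiseP a)/(_ (index b ord) (index a ord)) := pw.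
by rewrite !inE !index_mem !nth_index // ab => /(_ (mo b) (mo a) lt_ba).
Qed.

Lemma connect_index G ord a b :
  (forall c d, (c, d) \in G -> before ord c d) ->
  connect (arc_rel G) a b -> index a ord <= index b ord.
Proof.
move=> lt_ord /connectP[p pth ->]; elim: p a pth => //= c p IHp a /andP[ac pth].
by apply: leq_trans (IHp _ pth); apply/ltnW/lt_ord.
Qed.

Lemma pairwise_before (r : rel V) ord : uniq ord ->
  {in ord &, forall a b, before ord a b -> r a b} -> pairwise r ord.
Proof.
move=> uo H; case: ord => // c s in uo H *; set ord := c :: s in uo H *.
apply/(pairwiseP c) => i j; rewrite !inE => lti ltj ltij.
by apply: H; rewrite ?mem_nth // /before !index_uniq.
Qed.

Lemma perm_move l ord i :
  let rest := [seq a <- ord | a \notin l] in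
  uniq ord -> uniq l -> {subset l <= ord} ->
  perm_eq (take i rest ++ l ++ drop i rest) ord.
Proof.
move=> rest uo ul sub; rewrite perm_catCA cat_take_drop.
rewrite perm_sym -(perm_filterC (mem l)) perm_cat //.
apply: uniq_perm => //; first exact: filter_uniq.
by move=> a; rewrite mem_filter; apply: andb_idr; apply: sub.
Qed.

(** Serves both moves: after deleting [l], every remaining vertex is still on its old side of the
    pivot [t]. *)
Lemma rest_split l ord t : uniq ord -> t \in ord -> t \notin l ->
  exists s1 s2,
    [/\ [seq a <- ord | a \notin l] = s1 ++ t :: s2,
        index t (s1 ++ t :: s2) = size s1,
        {in s1, forall a, a \notin l /\ before ord a t} &
        {in s2, forall a, a \notin l /\ before ord t a}].
Proof.
move=> uo to tl; case/splitPr: to uo => s1 s2.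
rewrite cat_uniq /= => /and4P[_ /norP[ts1 /hasPn ds] ts2 _].
have it : index t (s1 ++ t :: s2) = size s1.
  by rewrite index_cat (negbTE ts1) /= eqxx addn0.
exists [seq a <- s1 | a \notin l], [seq a <- s2 | a \notin l].
split.
- by rewrite filter_cat /= tl.
- by rewrite index_cat mem_filter (negbTE ts1) andbF /= eqxx addn0.
- move=> a; rewrite mem_filter => /andP[al as1]; split=> //.
  by rewrite /before it index_cat as1 index_mem.
- move=> a; rewrite mem_filter => /andP[al as2]; split=> //.
  rewrite /before it index_cat (negbTE (ds _ as2)) /=.
  by case: eqP as2 ts2 => [-> ->|_]; rewrite // addnS ltnS leq_addr.
Qed.

Lemma pairwise_insert (r : rel V) s1 s2 l :
  pairwise r (s1 ++ s2) -> pairwise r l -> allrel r s1 l -> allrel r l s2 ->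
  pairwise r (s1 ++ l ++ s2).
Proof.
by rewrite !pairwise_cat allrel_catr => /and3P[-> -> ->] -> -> ->.
Qed.

(** The block lands before [t], so [t] itself counts among the vertices after the block; hence the
    negated [before] in the last condition. *)
Lemma pairwise_move_before (r : rel V) t l ord :
  uniq ord -> t \in ord -> t \notin l ->
  pairwise r [seq a <- ord | a \notin l] -> pairwise r l ->
  (forall a b, a \notin l -> before ord a t -> b \in l -> r a b) ->
  (forall a b, a \in l -> b \notin l -> ~~ before ord b t -> r a b) ->
  pairwise r (move_before t l ord).
Proof.
move=> uo to tl; rewrite /move_before.
have [s1 [s2 [-> -> lt1 lt2]]] := rest_split uo to tl.
rewrite take_size_cat // drop_size_cat // => pr pl rl lr.
apply: pairwise_insert => //; apply/allrelP => a b.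
  by move=> /lt1[al lta] bl; apply: rl.
move=> al; rewrite inE => /predU1P[->|/lt2[bl ltb]]; apply: lr => //.
  by rewrite /before ltnn.
by rewrite /before -leqNgt ltnW.
Qed.

Lemma pairwise_move_after (r : rel V) t l ord :
  uniq ord -> t \in ord -> t \notin l ->
  pairwise r [seq a <- ord | a \notin l] -> pairwise r l ->
  (forall a b, a \notin l -> ~~ before ord t a -> b \in l -> r a b) ->
  (forall a b, a \in l -> b \notin l -> before ord t b -> r a b) ->
  pairwise r (move_after t l ord).
Proof.
move=> uo to tl; rewrite /move_after.
have [s1 [s2 [-> -> lt1 lt2]]] := rest_split uo to tl.
rewrite -cat_rcons -(size_rcons s1 t) take_size_cat // drop_size_cat //.
move=> pr pl rl lr; apply: pairwise_insert => //; apply/allrelP => a b.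
  rewrite mem_rcons inE => /predU1P[->|/lt1[al lta]] bl; apply: rl => //.
    by rewrite /before ltnn.
  by rewrite /before -leqNgt ltnW.
by move=> al /lt2[bl ltb]; apply: lr.
Qed.

Lemma thresholdP ord v (AF : {set V * V}) :
  let t := threshold ord v AF in
  [/\ t = v \/ exists x, (t, x) \in AF,
      index t ord <= index v ord &
      forall a b, (a, b) \in AF -> index t ord <= index a ord].
Proof.
rewrite /threshold; case: arg_minnP => [|t]; first by rewrite eqxx.
move=> Pt min_t; split.
- by case/orP: Pt => [/eqP|/existsP]; [left | right].
- by apply: min_t; rewrite eqxx.
- by move=> a b ab; apply: min_t; apply/orP; right; apply/existsP; exists b.
Qed.
End Orders.

(* The part of the search state that concerns one direction; T lists the arcs
   traversed so far.  The forward search has [tl := fst] and [hd := snd], the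
   backward search swaps them, and P holds of the vertices that the search is
   able to reach. *)
Record explored (V : finType) (G : {set V * V}) (tl hd : V * V -> V)
    (P : pred V) (S : {set V}) (A : {set V * V}) (T : seq (V * V)) : Prop :=
  Explored {
    explored_reach : {in S, forall a, P a};
    explored_open : {in A, forall e, e \in G /\ tl e \in S};
    explored_done : {in T, forall e, [/\ e \in G, tl e \in S & hd e \in S]};
    explored_uniq : uniq T;
    explored_disj : {in T, forall e, e \notin A};
    explored_all : {in G, forall e, tl e \in S -> (e \in A) || (e \in T)}
  }.

(** * The search loop: its invariant and its length *)

Section Search.
Variables (V : finType) (G : {set V * V}).

Lemma explored_start tl hd (P : pred V) a :
  P a -> explored G tl hd P [set a] [set e in G | tl e == a] [::].
Proof.
move=> Pa; split=> //.
- by move=> b /set1P->.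
- by move=> e; rewrite !inE => /andP[].
- by move=> e eG; rewrite !inE eG => ->.
Qed.

Lemma explored_step tl hd (P : pred V) S A T e :
  {in G, forall e, P (tl e) -> P (hd e)} ->
  explored G tl hd P S A T -> e \in A ->
  explored G tl hd P (hd e |: S)
    (A :\ e :|: (if hd e \in S then set0 else [set f in G | tl f == hd e]))
    (e :: T).
Proof.
move=> P_closed [reach op don uT disj al] eA; have [eG te] := op _ eA.
split.
- by move=> a /setU1P[->|/reach//]; apply: P_closed => //; apply: reach.
- move=> f; rewrite !inE => /orP[/andP[_ /op[fG tf]]|].
    by rewrite tf orbT.
  by case: ifP; rewrite !inE // => _ /andP[-> ->].
- move=> f; rewrite !inE => /predU1P[->|/don[fG tf hf]].
    by rewrite eG te eqxx !orbT.
  by rewrite fG tf hf !orbT.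
- by rewrite /= uT andbT; apply: contraL eA; apply: disj.
(* Newly opened arcs have their tail [hd e] outside [S], while traversed arcs have theirs in [S], so
   no traversed arc is reopened. *)
- have open_new f : tl f \in S ->
      f \notin (if hd e \in S then set0 else [set f in G | tl f == hd e]).
    case: ifP => [|he] tf; rewrite !inE //.
    by apply: contraFN he => /andP[_ /eqP<-].
  move=> f; rewrite in_setU in_setD1 inE negb_or => /predU1P[->|fT].
    by rewrite eqxx open_new.
  by have [_ tf _] := don _ fT; rewrite open_new // (negbTE (disj _ fT)) andbF.
- move=> f fG; rewrite !inE; case: (eqVneq f e) => [_ _|_].
    by rewrite orbT.
  case: (boolP (tl f \in S)) => [/(al _ fG)/orP[->|->]|tf]; rewrite ?orbT //.
  by rewrite orbF => /eqP eqt; rewrite -eqt (negbTE tf) inE fG eqxx orbT.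
Qed.

Variables (ord : seq V) (v w : V).

(** One step may put the same vertex into both [F] and [B], so their disjointness is not an
    invariant; [state_once] is a weaker fact that survives. *)
Record search_state (F B : {set V}) (AF AB : {set V * V})
    (T : seq ((V * V) * (V * V))) : Prop := SearchState {
  state_forward :
    explored G fst snd (connect (arc_rel G) w) F AF (unzip1 T);
  state_backward :
    explored G snd fst (fun a => connect (arc_rel G) a v) B AB (unzip2 T);
  state_w : w \in F;
  state_v : v \in B;
  state_compatible : {in T, forall p, before ord p.1.1 p.2.2};
  state_once : {in unzip1 T, forall e, e \notin unzip2 T}
}.

Lemma search_state_start :
  search_state [set w] [set v] (arcs_from G w) (arcs_into G v) [::].
Proof.
split; rewrite ?set11 //.
  exact: (@explored_start fst snd (connect (arc_rel G) w) w (connect0 _ _)).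
exact: (@explored_start snd fst (fun a => connect (arc_rel G) a v) v
  (connect0 _ _)).
Qed.

Lemma search_state_step F B AF AB T u x y z :
  search_state F B AF AB T ->
  (u, x) \in AF -> (y, z) \in AB -> before ord u z ->
  x \notin B -> y \notin F ->
  search_state (x |: F) (y |: B)
    (AF :\ (u, x) :|: (if x \in F then set0 else arcs_from G x))
    (AB :\ (y, z) :|: (if y \in B then set0 else arcs_into G y))
    (((u, x), (y, z)) :: T).
Proof.
move=> [fwd bwd wF vB comp once] ux yz ltuz xB yF; split.
- apply: (explored_step _ fwd ux) => e eG; move/connect_trans; apply.
  exact: arc_connect.
- apply: (explored_step _ bwd yz) => e eG; apply: connect_trans.
  exact: arc_connect.
- exact: setU1r.
- exact: setU1r.
- by move=> p; rewrite inE => /predU1P[->|/comp].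
(* A repeated arc would have had its head in [B] or its tail [y] in [F], and both are excluded by
   the cycle tests. *)
- have [_ uF] := explored_open fwd ux; have [_ zB] := explored_open bwd yz.
  move=> e /=; rewrite !inE negb_or => /predU1P[->|eT].
    apply/andP; split; first by apply: contraNneq yF => -[<-].
    by apply: contra xB => /(explored_done bwd)[].
  rewrite once // andbT; apply: contraNneq yF => eq_e.
  by have [_ + _] := explored_done fwd eT; rewrite eq_e.
Qed.

(** By [state_once] the forward and the backward traversals together form one duplicate-free list of
    arcs of [G]. *)
Lemma state_size F B AF AB T :
  search_state F B AF AB T -> (size T).*2 <= #|G|.
Proof.
move=> [fwd bwd _ _ _ once].
have ->: (size T).*2 = size (unzip1 T ++ unzip2 T).
  by rewrite size_cat !size_map addnn.
rewrite cardE.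
apply: uniq_leq_size.
  rewrite cat_uniq (explored_uniq fwd) (explored_uniq bwd) andbT /=.
  by apply/hasPn => e e2; apply: contraTN e2; apply: once.
move=> e; rewrite mem_cat mem_enum.
by case/orP => [/(explored_done fwd)|/(explored_done bwd)] [].
Qed.

(** The state is arbitrary so that induction on the loop applies. The pair that reveals a cycle does
    not enter [T], hence the 2 added to the bound of [state_size]. *)
Lemma search_result_state F B AF AB T r k :
  search G ord F B AF AB r k -> search_state F B AF AB T ->
  match r with
  | CycleArc _ => is_true ((size T).*2 + k <= #|G| + 2)
  | Null F' B' AF' => exists AB' T',
      [/\ search_state F' B' AF' AB' T',
          forall u x y z, (u, x) \in AF' -> (y, z) \in AB' ->
            ~~ before ord u z &
          (size T).*2 + k = (size T').*2]
  end.
Proof.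
move=> sr; elim: sr T => {F B AF AB r k}.
- by move=> F B AF AB stop T st; exists AB, T; rewrite addn0.
- by move=> F B AF AB u x y z _ _ _ _ T /state_size; rewrite leq_add2r.
- by move=> F B AF AB u x y z _ _ _ _ _ T /state_size; rewrite leq_add2r.
move=> F B AF AB u x y z r k ux yz ltuz xB yF _ IH T st.
have := IH _ (search_state_step st ux yz ltuz xB yF).
by rewrite /= doubleS -addn2 -addnA (addnC 2) .
Qed.

Lemma compatible_search_leq r k :
  compatible_search G ord v w r k -> k <= #|G| + 2.
Proof.
move=> /search_result_state/(_ search_state_start).
rewrite double0 add0n; case: r => // F B AF [AB [T [/state_size leT _ ->]]].
exact: leq_trans leT (leq_addr _ _).
Qed.

End Search.

(** * Reordering restores a topological order *)

(** Arcs out of [lF] stay in [F] and, if [t != v], arcs into [lB] come from [B]. The sets [F] and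
    [B] are disjoint because [w] does not reach [v]. Hence no arc between a moved block and the rest
    points backwards. *)
Lemma reordered_topological (V : finType) (G : {set V * V}) ord v w F B AF AB T
    ord' :
  ~ has_cycle ((v, w) |: G) -> topological G [set: V] ord -> before ord w v ->
  search_state G ord v w F B AF AB T ->
  (forall u x y z, (u, x) \in AF -> (y, z) \in AB -> ~~ before ord u z) ->
  reordered ((v, w) |: G) ord v F B AF ord' ->
  topological ((v, w) |: G) [set: V] ord'.
Proof.
move=> acG' topG ltwv [fwd bwd wF vB _ _] stop.
have [uo mo lt_ord] := topologicalP (acyclicW acG') topG.
have [t_cases le_tv t_min] := thresholdP ord v AF.
rewrite /reordered; set t := threshold ord v AF in t_cases le_tv t_min *.
case=> lF [lB [/andP[pF pwF] /andP[pB pwB] ->]].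
have nwv : ~~ connect (arc_rel G) w v.
  apply/negP => cwv; have := acyclic_connect acG' (setU11 _ _).
  by move/negP; apply; apply: connect_setU1.
have disjFB a : a \in F -> a \notin B.
  move=> /(explored_reach fwd) wa; apply: contra nwv => /(explored_reach bwd).
  exact: connect_trans.
have mF a : (a \in lF) = (a \in F) && before ord a t.
  by rewrite (perm_mem pF) mem_enum inE.
have mB a : (a \in lB) = (a \in B) && before ord t a.
  by rewrite (perm_mem pB) mem_enum inE.
have uF : uniq lF by rewrite (perm_uniq pF) enum_uniq.
have uB : uniq lB by rewrite (perm_uniq pB) enum_uniq.
(* An untraversed arc out of [a] would be in [AF], but [t] is at or before all tails in [AF]. *)
have close_F a b : a \in lF -> (a, b) \in G -> b \in F.
  rewrite mF => /andP[aF ltat] abG.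
  case/orP: (explored_all fwd abG aF) => [/t_min|/(explored_done fwd)[]//].
  by rewrite leqNgt; move: ltat; rewrite /before => ->.
have tlF : t \notin lF by rewrite mF /before ltnn andbF.
have tlB : t \notin lB by rewrite mB /before ltnn andbF.
have rest_G (l : seq V) :
    pairwise (fun a b => (b, a) \notin G) [seq a <- ord | a \notin l].
  by apply: pairwise_filter; case/andP: topG.
(* The new arc is the only one that [ord] violates, and it leaves the rest once one of its ends is
   moved. *)
have rest_G' (l : seq V) : (v \in l) || (w \in l) ->
    pairwise (fun a b => (b, a) \notin (v, w) |: G) [seq a <- ord | a \notin l].
  move=> vwl; apply: (sub_in_pairwise _ (filter_all _ _) (rest_G l)).
  move=> a b al bl /=; apply: contra => /setU1P[[eqb eqa]|//].
  by move: vwl; rewrite -eqb -eqa (negbTE al) (negbTE bl).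
have ord_inj a b : index a ord = index b ord -> a = b.
  by move=> eqi; rewrite -(nth_index a (mo a)) eqi nth_index.
have perm_topo l : perm_eq l ord -> perm_eq l (enum [set: V]).
  by move/permPl=> ->; case/andP: topG.
have [eq_tv|neq_tv] := eqVneq t v.
  have wlF : w \in lF by rewrite mF wF eq_tv.
  apply/andP; split.
    by apply: perm_topo; exact: perm_move.
  apply: pairwise_move_after => //; first by apply: rest_G'; rewrite wlF orbT.
  - move=> a b al leat blF; apply/setU1P => -[[eqb _]|baG].
      by rewrite eqb -eq_tv (negbTE tlF) in blF.
    have aF := close_F _ _ blF baG.
    rewrite mF aF /= /before -leqNgt in al; rewrite /before -leqNgt in leat.
    have eqat : a = t by apply: ord_inj; apply/eqP; rewrite eqn_leq leat.
    by have := disjFB _ aF; rewrite eqat eq_tv vB.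
  - move=> a b + _ lttb; rewrite mF => /andP[_ ltat].
    apply/setU1P => -[[eqb _]|/lt_ord ltba].
      by rewrite eqb eq_tv /before ltnn in lttb.
    by have := ltn_trans ltba (ltn_trans ltat lttb); rewrite ltnn.
have [x tx] : exists x, (t, x) \in AF.
  by case: t_cases => // eq_tv; rewrite eq_tv eqxx in neq_tv.
have [_ /= tF] := explored_open fwd tx.
(* As [(t, x)] is still open, the exit condition forbids an open backward arc whose head is after
   [t]. *)
have close_B a b : b \in lB -> (a, b) \in G -> a \in B.
  rewrite mB => /andP[bB lttb] abG.
  case/orP: (explored_all bwd abG bB); last by case/(explored_done bwd).
  by move/(stop _ _ _ _ tx); rewrite lttb.
have vlB : v \in lB.
  rewrite mB vB /before ltn_neqAle le_tv andbT /=.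
  by apply: contraNneq neq_tv => /ord_inj->.
have disj_l a : a \in lB -> a \notin lF.
  by rewrite mB mF => /andP[aB _]; apply: contraL aB => /andP[/disjFB].
apply/andP; split.
  apply: perm_topo; apply: perm_move => //.
  by rewrite cat_uniq uB uF andbT; apply/hasPn => a; apply: contraL => /disj_l.
apply: pairwise_move_before => //.
- by rewrite mem_cat negb_or tlB.
- by apply: rest_G'; rewrite mem_cat vlB.
- rewrite pairwise_cat pwB pwF !andbT; apply/allrelP => a b alB blF.
  apply/setU1P => -[[eqb _]|baG].
    by have := disj_l _ vlB; rewrite -eqb blF.
  have := disjFB _ (close_F _ _ blF baG); rewrite mB in alB.
  by case/andP: alB => ->.
- move=> a b; rewrite !mem_cat negb_or => /andP[alB alF] ltat bl.
  apply/setU1P => -[[_ eqa]|baG]; first by rewrite mF eqa wF -eqa ltat in alF.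
  case/orP: bl => [|blF]; last by rewrite mF ltat (close_F _ _ blF baG) in alF.
  rewrite mB => /andP[_ lttb].
  by have := ltn_trans (lt_ord _ _ baG) (ltn_trans ltat lttb); rewrite ltnn.
- move=> a b; rewrite !mem_cat negb_or => al /andP[blB blF].
  rewrite /before -leqNgt => le_tb.
  apply/setU1P => -[[eqb _]|baG]; first by rewrite eqb vlB in blB.
  case/orP: al => [alB|].
    have bB := close_B _ _ alB baG.
    rewrite mB bB /= /before -leqNgt in blB.
    have eqbt : b = t by apply: ord_inj; apply/eqP; rewrite eqn_leq blB.
    by have := disjFB _ tF; rewrite -eqbt bB.
  rewrite mF => /andP[_ ltat].
  by have := ltn_trans (lt_ord _ _ baG) (leq_trans ltat le_tb); rewrite ltnn.
Qed.

(** * Counting linked pairs of arcs *)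

Section Linked.
Variable V : finType.
Implicit Types (G : {set V * V}) (ord : seq V) (e : V * V).

Definition linked G : {set (V * V) * (V * V)} :=
  [set p | [&& p.1 \in G, p.2 \in G & connect (arc_rel G) p.1.2 p.2.1]].

Lemma linked_sub G e : linked G \subset linked (e |: G).
Proof.
apply/subsetP => p; rewrite !inE => /and3P[-> -> conn]; rewrite !orbT /=.
exact: connect_setU1.
Qed.

Lemma card_swap (T : finType) (A : {set T * T}) :
  #|[set (p.2, p.1) | p in A]| = #|A|.
Proof. by rewrite card_imset // => -[a b] [c d] [-> ->]. Qed.

(** Two arcs linked in both directions, or one arc linked to itself, would lie on a cycle; so
    [linked G] and its transpose are disjoint subsets of the square of [G]. *)
Lemma card_linked G : ~ has_cycle G -> #|linked G|.*2 <= #|G| ^ 2.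
Proof.
move=> acG; rewrite -addnn -{2}(card_swap (linked G)) -mulnn -cardsX.
rewrite -[X in X <= _]subn0; set L := linked G; set L' := imset _ _.
have dis : L :&: L' = set0.
  apply/setP => -[e f]; rewrite in_set0; apply/negP => /setIP[].
  rewrite inE => /and3P[/= eG fG ef] /imsetP[[g h] + [eqe eqf]].
  rewrite -{}eqe -{}eqf inE => /and3P[_ _ /= fe].
  have := acyclic_connect (a := e.1) (b := e.2) acG.
  rewrite -surjective_pairing.
  move/(_ eG)/negP; apply; apply: connect_trans ef _.
  exact: connect_trans (arc_connect fG) fe.
rewrite -(cards0 ((V * V) * (V * V))%type) -dis -cardsU subset_leq_card //.
apply/subsetP => p /setUP[|/imsetP[q + ->]]; rewrite !inE => /and3P[pG qG _];
  by rewrite /= pG qG.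
Qed.

(* Among any two traversed pairs (f, b) and (f', b') one of (b, f') and (b', f)
   is ordered by [before], hence half of all the pairs become linked. *)
Lemma linked_search G ord v w F B AF AB T :
  ~ has_cycle ((v, w) |: G) -> topological G [set: V] ord ->
  search_state G ord v w F B AF AB T ->
  #|linked G|.*2 + size T ^ 2 <= #|linked ((v, w) |: G)|.*2.
Proof.
move=> acG' topG [fwd bwd _ _ comp _].
have [uo mo lt_ord] := topologicalP (acyclicW acG') topG.
pose n := size T; pose t := tnth (in_tuple T) : 'I_n -> _.
have tT i : t i \in T by apply: mem_tnth.
have fT i : (t i).1 \in unzip1 T by apply: map_f.
have bT i : (t i).2 \in unzip2 T by apply: map_f.
have tE (x0 : (V * V) * (V * V)) i : t i = nth x0 T i by exact: tnth_nth.
have t1_inj i j : (t i).1 = (t j).1 -> i = j.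
  pose x0 := t i; rewrite !(tE x0) -!(nth_map x0 x0.1 fst) // => /eqP.
  by rewrite nth_uniq ?size_map ?(explored_uniq fwd) // => /eqP/val_inj.
have t2_inj i j : (t i).2 = (t j).2 -> i = j.
  pose x0 := t i; rewrite !(tE x0) -!(nth_map x0 x0.2 snd) // => /eqP.
  by rewrite nth_uniq ?size_map ?(explored_uniq bwd) // => /eqP/val_inj.
(* Positions in [T] index the traversed pairs; [(i, j)] is selected when the forward arc of [i] is
   compatible with the backward arc of [j]. *)
pose S := [set p : 'I_n * 'I_n | before ord (t p.1).1.1 (t p.2).2.2].
pose new := [set ((t p.2).2, (t p.1).1) | p in S].
have card_new : #|new| = #|S|.
  by rewrite card_imset // => -[i j] [i' j'] [/= /t2_inj-> /t1_inj->].
have card_S : n ^ 2 <= #|S|.*2.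
  rewrite -mulnn -{1 2}[n]card_ord -cardX -addnn -{2}(card_swap S).
  rewrite -cardsT.
  have -> : [set: 'I_n * 'I_n] = S :|: [set (p.2, p.1) | p in S].
    apply/esym/setP => -[i j]; rewrite in_setT in_setU.
    apply/orP; have [lt_ij|ge_ij] := boolP (before ord (t i).1.1 (t j).2.2).
      by left; rewrite inE.
    right; apply/imsetP; exists (j, i) => //; rewrite inE /=.
    (* The chain is: forward tail of [j] < backward head of [j] <= forward tail of [i] < backward
       head of [i]. *)
    move: ge_ij (comp _ (tT i)) (comp _ (tT j)); rewrite /before -leqNgt.
    move=> ge_ij lt_i lt_j.
    exact: leq_trans (leq_trans lt_j ge_ij) (ltnW lt_i).
  by rewrite cardsU leq_subr.
have new_linked : new \subset linked ((v, w) |: G).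
  apply/subsetP => _ /imsetP[[i j] _ ->]; rewrite inE /=.
  have [bG bB _] := explored_done bwd (bT j).
  have [fG fF _] := explored_done fwd (fT i).
  rewrite !setU1r //=.
  apply: connect_trans (connect_setU1 _ (explored_reach bwd bB)) _.
  apply: connect_trans (connect_setU1 _ (explored_reach fwd fF)).
  by apply: connect1; apply: setU11.
have new_unlinked : linked G :&: new = set0.
  apply/setP => p; rewrite in_set0; apply/negP => /setIP[].
  rewrite inE => /and3P[_ _ conn] /imsetP[[i j] + def_p].
  have := connect_index lt_ord conn; rewrite def_p inE /= /before leqNgt.
  by move/negbTE->.
apply: leq_trans (leq_add (leqnn _) card_S) _.
rewrite -doubleD leq_double -card_new -[X in X <= _]subn0.
rewrite -(cards0 ((V * V) * (V * V))%type) -new_unlinked -cardsU.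
by rewrite subset_leq_card // subUset linked_sub.
Qed.

Lemma add_arc_leq G ord e o k : add_arc G ord e o k -> k <= #|G| + 2.
Proof. by case=> // *; apply: compatible_search_leq; eassumption. Qed.

(** The amortised cost of one addition: [2 j] traversals are paid for by [j ^ 2] in twice the number
    of linked pairs, with [j = 0] when no search is run. *)
Lemma add_arc_continue G ord e ord' k :
  add_arc G ord e (Some ord') k ->
  ~ has_cycle (e |: G) -> topological G [set: V] ord ->
  topological (e |: G) [set: V] ord' /\
  exists2 j, k = j.*2 & #|linked G|.*2 + j ^ 2 <= #|linked (e |: G)|.*2.
Proof.
move def_o : (Some ord') => o add acG' topG.
case: add def_o acG' => //.
- move=> v w ltvw [->] acG'.
  have [uo mo lt_ord] := topologicalP (acyclicW acG') topG.
  split.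
    apply/andP; split; first by case/andP: topG.
    apply: pairwise_before => // a b _ _; rewrite /before => ltab.
    apply/setU1P => -[[eqb eqa]|/lt_ord ltba].
      rewrite -eqa -eqb in ltvw.
      by have := ltn_trans ltab ltvw; rewrite ltnn.
    by have := ltn_trans ltab ltba; rewrite ltnn.
  by exists 0; rewrite // addn0 leq_double subset_leq_card // linked_sub.
move=> v w F B AF ord1 {}k ltwv search re [->] acG'.
have [AB [T [st stop eqk]]] :=
  search_result_state search (search_state_start G ord v w).
split; first exact: (reordered_topological acG' topG ltwv st stop re).
exists (size T); first by rewrite -eqk.
exact: linked_search st.
Qed.

(** * Summation over the run *)

Local Open Scope ring_scope.

(* [s] will be the square root of the number of arcs: it optimises the bound
   [2 j s <= s ^+ 2 + j ^+ 2] for a search that traverses [j] pairs of arcs. *)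
Lemma run_leq (R : realFieldType) (s : R) G ord arcs k
    (N := (#|G| + size arcs)%N) :
  run G ord arcs k -> 0 <= s ->
  ~ has_cycle G -> topological G [set: V] ord -> uniq arcs ->
  {in arcs, forall e, e \notin G} ->
  k%:R * s + #|linked G|.*2%:R <=
    (size arcs)%:R * s ^+ 2 + N.+1%:R * s + (N ^ 2)%:R.
Proof.
move=> r s0; rewrite {}/N; elim: r => {G ord arcs k}.
- move=> G ord acG _ _ _; rewrite !mul0r !add0r addn0.
  by rewrite ler_wpDl ?mulr_ge0 ?ler0n // ler_nat card_linked.
- move=> G ord e arcs o k add _ acG _ _ _; rewrite lerD //.
    rewrite ler_wpDl ?mulr_ge0 ?ler0n ?exprn_ge0 // ler_wpM2r // ler_nat.
    (* The arc [e] itself counts in [N], so [#|G| + 2] is at most [N.+1]. *)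
    by apply: leq_trans (add_arc_leq add) _; rewrite addn2 addnS !ltnS leq_addr.
  rewrite ler_nat; apply: leq_trans (card_linked acG) _.
  by rewrite leq_exp2r // leq_addr.
move=> G ord e arcs ord' k k' add acG' _ IH acG topG /=.
move=> /andP[e_arcs u_arcs] newG.
have [topG' [j -> link]] := add_arc_continue add acG' topG.
have eG : e \notin G by apply: newG; rewrite mem_head.
(* [N] is unchanged, since [e] passes from the list to the graph. *)
have {IH} := IH acG' topG' u_arcs; rewrite cardsU1 eG add1n addSnnS.
move=> /(_ _)/wrap[].
  move=> f f_arcs; rewrite !inE negb_or newG ?inE ?f_arcs ?orbT // andbT.
  by apply: contraNneq e_arcs => <-.
move: link; rewrite -(ler_nat R) natrD natrX => link IH.
(* Of [2 j s <= s ^+ 2 + j ^+ 2], the first term is charged to the arc [e] and the second to the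
   newly linked pairs. *)
have amgm := sqr_ge0 (s - j%:R).
set N := (_ + (size arcs).+1)%N in IH *.
rewrite -(natr1 (size arcs)) [(_ + k')%:R]natrD -(addnn j) (natrD _ j j).
have {link IH} := lerD link IH; rewrite -natr1.
lra.
Qed.

End Linked.

(** * The bound for the whole sequence *)

Local Open Scope ring_scope.

Theorem theorem3p3 (R : realType) (V : finType) (m : nat)
    (arcs : seq (V * V)) (ord0 : seq V) (k : nat)
    (size_arcs : size arcs = m) (arcs_uniq : uniq arcs)
    (ord0_topological : topological set0 [set: V] ord0)
    (arcs_run : run set0 ord0 arcs k) :
  (k%:R : R) <= 4 * (m%:R `^ (3 / 2)) + m%:R + 1.
Proof.
have ac0 : ~ has_cycle (set0 : {set V * V}).
  by case=> -[|a [|b c]] //=; rewrite inE.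
(* The case of no arcs is separate because the final division by [s] needs [s > 0]. *)
have [m0|m_gt0] := posnP m.
  have -> : k = 0%N.
    by move/size0nil: (etrans size_arcs m0) arcs_run => ->; case E : _ _ /.
  by rewrite addr_ge0 // addr_ge0 // mulr_ge0 // powR_ge0.
pose s : R := Num.sqrt m%:R.
have s_gt0 : 0 < s by rewrite sqrtr_gt0 ltr0n.
have sqr_s : m%:R = s ^+ 2 by rewrite sqr_sqrtr ?ler0n.
have -> : (m%:R : R) `^ (3 / 2) = s ^+ 3.
  by rewrite mulrC powRrM powR12_sqrt ?ler0n // -powR_mulrn ?ltW.
have := run_leq arcs_run (ltW s_gt0) ac0 ord0_topological arcs_uniq.
move=> /(_ _)/wrap[]; first by move=> e _; rewrite inE.
rewrite cards0 add0n size_arcs natrX -natr1 sqr_s => bound.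
have : 0 <= #|linked (set0 : {set V * V})|.*2%:R :> R by rewrite ler0n.
(* With [m = s ^+ 2], [bound] limits [k * s] to [2 * s ^+ 4 + (m + 1) * s]; positivity of [s ^+ 4]
   covers the slack up to the constant 4. *)
rewrite -(ler_pM2r s_gt0); have := exprn_gt0 4 s_gt0.
nra.
Qed.
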